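(* Let $R>0$, $m\in\mathbb{Z}$, $\lambda\in\mathbb{R}$, and suppose that $m^2+r^2\lambda>0$ for all $r\in[0,R]$. Then there exists no nontrivial solution pair $(A,\lambda)$ of the boundary value problem $$\frac{d^2A}{dr^2}+\frac1r\frac{dA}{dr}-\frac{m^2}{r^2}A-\lambda A+\frac{A^3}{(1+A^2)^2}=0,\quad r\in(0,R),\qquad A(0)=0=A(R),$$ whose photon number satisfies $$N(A)=2\pi\int_0^R rA^2\,dr=N_0\quad\text{with } 0<N_0\le \frac12.$$
   Context: A solution pair $(A,\lambda)$ consists of a real number $\lambda$ (the nonlinear frequency shift) and a real-valued function $A$, continuous on $[0,R]$ and twice differentiable on $(0,R)$, satisfying the differential equation on $(0,R)$ and the boundary conditions. It is nontrivial if $A\not\equiv0$. *)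

(* Defs.v *)
From Stdlib Require Import Reals ZArith.
From Coquelicot Require Import Coquelicot.
Open Scope R_scope.

(* The interval [0, R] of the problem is [0, rad], since R denotes the reals.
   A function on [0, rad] is the restriction of some A : R -> R: every notion
   below depends only on the values of A on [0, rad].  [continuous_on] is
   continuity relative to the set, so it is one-sided at 0 and at rad. *)

Definition twice_differentiable_on (D : R -> Prop) (A : R -> R) : Prop :=
  forall r, D r -> ex_derive A r /\ ex_derive (Derive A) r.

Definition ode (m : Z) (lambda : R) (A : R -> R) (r : R) : Prop :=
  Derive (Derive A) r + 1 / r * Derive A r - (IZR m) ^ 2 / r ^ 2 * A r
    - lambda * A r + A r ^ 3 / (1 + A r ^ 2) ^ 2 = 0.

Definition solution_pair (rad : R) (m : Z) (A : R -> R) (lambda : R) : Prop :=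
  continuous_on (fun r => 0 <= r <= rad) A /\
  twice_differentiable_on (fun r => 0 < r < rad) A /\
  (forall r, 0 < r < rad -> ode m lambda A r) /\
  A 0 = 0 /\ A rad = 0.

Definition nontrivial (rad : R) (A : R -> R) : Prop :=
  exists r, 0 <= r <= rad /\ A r <> 0.

Definition photon_number (rad : R) (A : R -> R) : R :=
  2 * PI * RInt (fun r => r * A r ^ 2) 0 rad.

(* Main.v *)
Require Import Defs.
From Stdlib Require Import Reals ZArith Lra.
From Coquelicot Require Import Coquelicot.
Open Scope R_scope.

(** The proof plays the energy identity against a two-dimensional
    Gagliardo-Nirenberg inequality for radial functions.

    Multiplying the equation by [r * A] and integrating over [a, b] gives
    int r A'^2 + int (m^2 + lambda r^2) A^2 / r
      = int r A^4 / (1 + A^2)^2 + [r A A']_a^b.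
    The second integral is nonnegative by the sign hypothesis, and the first
    term on the right is at most int r A^4.  Nothing is known about [A'] at the
    ends of the interval, so [a] and [b] are chosen by the mean value theorem
    where (A^2)' has the favourable sign, which makes the bracket nonpositive;
    hence G := int r A'^2 <= int r A^4 ([energy_inequality]).

    In the other direction let K := int r |(A^2)'| and eps := b A(b)^2.  The
    embedding of W^{1,1} into L^2 in the plane, applied to A^2, gives
    int r A^4 <= (eps + K)^2 and r A(r)^2 <= eps + K ([radial_sobolev]).  The
    weighted inequality t K <= t^2 M + G, where M := int r A^2 ([RInt_amgm]),
    taken at t = 4 K, gives 2 K^2 <= G as soon as M <= 1/8; this is implied by
    2 pi M <= 1/2 because pi > 2.

    Altogether 2 K^2 <= (eps + K)^2, which fails once 3 eps <= K.  Now
    eps can be made small by taking [b] close to the right end, where A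
    vanishes, while K stays above r0 A(r0)^2 - eps for a fixed r0 with
    A(r0) <> 0. *)

(** * Integrals of functions continuous on an interval *)

Lemma ex_RInt_continuous_le (f : R -> R) (a b : R) :
  a <= b -> (forall x, a <= x <= b -> continuous f x) -> ex_RInt f a b.
Proof.
intros hab hf; apply (ex_RInt_continuous (V := R_CompleteNormedModule)).
rewrite Rmin_left, Rmax_right; auto.
Qed.

Lemma RInt_mono_interval (f : R -> R) (a b c d : R) :
  a <= c -> c <= d -> d <= b -> ex_RInt f a b ->
  (forall x, a < x < b -> 0 <= f x) -> RInt f c d <= RInt f a b.
Proof.
intros hac hcd hdb hf hpos.
assert (hac' : ex_RInt f a c) by (apply (ex_RInt_Chasles_1 (V := R_CompleteNormedModule)) with b; [lra | easy]).
assert (hcb : ex_RInt f c b) by (apply (ex_RInt_Chasles_2 (V := R_CompleteNormedModule)) with a; [lra | easy]).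
assert (hcd' : ex_RInt f c d) by (apply (ex_RInt_Chasles_1 (V := R_CompleteNormedModule)) with b; [lra | easy]).
assert (hdb' : ex_RInt f d b) by (apply (ex_RInt_Chasles_2 (V := R_CompleteNormedModule)) with c; [lra | easy]).
rewrite <- (RInt_Chasles f a c b), <- (RInt_Chasles f c d b); auto.
change plus with Rplus.
assert (0 <= RInt f a c) by (apply RInt_ge_0; auto; intros; apply hpos; lra).
assert (0 <= RInt f d b) by (apply RInt_ge_0; auto; intros; apply hpos; lra).
lra.
Qed.

Lemma is_derive_continuous (f : R -> R) (x l : R) :
  is_derive f x l -> continuous f x.
Proof. now intros hf; apply (ex_derive_continuous (V := R_NormedModule)); exists l. Qed.

Lemma is_derive_RInt_open (g : R -> R) (lo hi c x : R) :
  (forall y, lo < y < hi -> continuous g y) -> lo < c < hi -> lo < x < hi ->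
  is_derive (fun y => RInt g c y) x (g x).
Proof.
intros hg hc hx.
apply (is_derive_RInt (V := R_NormedModule)) with c; [ | auto].
apply filter_imp with (fun y => lo < y < hi).
- intros y hy; apply (RInt_correct (V := R_CompleteNormedModule)).
  apply (ex_RInt_continuous (V := R_CompleteNormedModule)); intros z hz; apply hg.
  revert hz; unfold Rmin, Rmax; destruct (Rle_dec c y); lra.
- apply (open_and (fun y => lo < y) (fun y => y < hi)); auto using open_gt, open_lt.
Qed.

(** The difference of the two sides has derivative [g - dF >= 0], so it grows by
    the mean value theorem. *)
Lemma increment_le_RInt (F dF g : R -> R) (lo hi a b : R) :
  (forall x, lo < x < hi -> is_derive F x (dF x)) ->
  (forall x, lo < x < hi -> continuous g x) ->
  (forall x, lo < x < hi -> dF x <= g x) ->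
  lo < a -> a <= b -> b < hi ->
  F b - F a <= RInt g a b.
Proof.
intros hF hg hle hlo hab hhi.
assert (hd : forall x, lo < x < hi ->
  is_derive (fun y => RInt g a y - F y) x (g x - dF x)).
{ intros x hx; apply (is_derive_minus (V := R_NormedModule)); auto.
  apply is_derive_RInt_open with lo hi; auto; lra. }
destruct (MVT_gen (fun y => RInt g a y - F y) a b (fun x => g x - dF x))
  as [c [hc heq]]; rewrite Rmin_left, Rmax_right in *; auto.
- intros x hx; apply hd; lra.
- intros x hx; apply continuity_pt_filterlim.
  apply (is_derive_continuous (fun y => RInt g a y - F y) x (g x - dF x)), hd; lra.
- rewrite RInt_point in heq; change zero with 0 in heq.
  assert (0 <= (g c - dF c) * (b - a)); [ | lra].
  apply Rmult_le_pos; [ | lra].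
  generalize (hle c ltac:(lra)); lra.
Qed.

(** * A Gagliardo-Nirenberg inequality for radial functions *)

(** The embedding of W^{1,1} into L^2 for radial functions of the plane.  The
    idea is to replace [f] by the nonincreasing majorant
    h(r) = f(b) + int_r^b |f'|.  Integrating (r h)' = h - r |f'| gives
    r h(r) + int_r^b h = b f(b) + int_r^b s |f'(s)| ds <= C, which bounds both
    r h(r) and int_a^b h by C; then r f^2 <= (r h) h integrates to C^2.
    Differentiability on the larger interval (lo, hi) avoids one-sided
    derivatives at [a] and [b]. *)
Lemma radial_sobolev (f df : R -> R) (lo hi a b : R) :
  0 <= lo -> lo < a -> a <= b -> b < hi ->
  (forall x, lo < x < hi -> is_derive f x (df x)) ->
  (forall x, lo < x < hi -> continuous df x) ->
  (forall x, 0 <= f x) ->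
  let C := b * f b + RInt (fun x => x * Rabs (df x)) a b in
  (forall r, a <= r <= b -> r * f r <= C) /\
  RInt (fun x => x * f x ^ 2) a b <= C ^ 2.
Proof.
intros h0 hlo hab hhi hf hdf hpos C.
assert (hcabs : forall x, lo < x < hi -> continuous (fun y => Rabs (df y)) x).
{ intros x hx; apply continuous_Rabs_comp; auto. }
assert (hcxabs : forall x, lo < x < hi -> continuous (fun y => y * Rabs (df y)) x).
{ intros x hx; apply (continuous_mult (K := R_AbsRing)); [apply continuous_id | auto]. }
set (h := fun x => f b - RInt (fun y => Rabs (df y)) b x).
assert (hh : forall x, lo < x < hi -> is_derive h x (- Rabs (df x))).
{ intros x hx; unfold h.
  replace (- Rabs (df x)) with (0 - Rabs (df x)) by ring.
  apply (is_derive_minus (V := R_NormedModule)); [apply (is_derive_const (V := R_NormedModule)) | ].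
  apply (is_derive_RInt_open (fun y => Rabs (df y)) lo hi); auto; lra. }
assert (hb : h b = f b).
{ unfold h; rewrite RInt_point; change zero with 0; ring. }
assert (hch : forall x, lo < x < hi -> continuous h x).
{ intros x hx; apply is_derive_continuous with (- Rabs (df x)); auto. }
assert (hfh : forall r, a <= r <= b -> f r <= h r).
{ intros r hr; unfold h.
  assert (e1 : ex_RInt (fun y => Rabs (df y)) r b)
    by (apply ex_RInt_continuous_le; [lra | intros; apply hcabs; lra]).
  rewrite <- (opp_RInt_swap (V := R_CompleteNormedModule)) by exact e1.
  change opp with Ropp.
  enough ((- f b) - (- f r) <= RInt (fun y => Rabs (df y)) r b) by lra.
  apply (increment_le_RInt (fun x => - f x) (fun x => - df x) _ lo hi); auto; try lra.
  - intros x hx; apply (is_derive_opp (V := R_NormedModule)); auto.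
  - intros x hx; rewrite <- Rabs_Ropp; apply Rle_abs. }
assert (hrC : forall r, a <= r <= b -> r * h r + RInt h r b <= C).
{ intros r hr.
  assert (e1 : ex_RInt (fun x => x * Rabs (df x)) r b)
    by (apply ex_RInt_continuous_le; [lra | intros; apply hcxabs; lra]).
  assert (e2 : ex_RInt h r b)
    by (apply ex_RInt_continuous_le; [lra | intros; apply hch; lra]).
  assert (hi1 : (- (b * h b)) - (- (r * h r))
            <= RInt (fun x => minus (x * Rabs (df x)) (h x)) r b).
  { apply (increment_le_RInt (fun x => - (x * h x)) (fun x => x * Rabs (df x) - h x) _ lo hi);
      try lra.
    - intros x hx.
      assert (hx' := hh x hx).
      auto_derive; [eexists; apply hx' | ].
      replace (Derive (fun x0 => h x0) x) with (- Rabs (df x)); [ring | ].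
      symmetry; now apply is_derive_unique.
    - intros x hx; apply (continuous_minus (V := R_NormedModule)); auto.
    - intros x hx; change minus with Rminus; apply Rle_refl. }
  rewrite (RInt_minus (V := R_CompleteNormedModule)) in hi1 by assumption.
  change (minus ?u ?v) with (u - v) in hi1.
  assert (RInt (fun x => x * Rabs (df x)) r b <= RInt (fun x => x * Rabs (df x)) a b).
  { apply RInt_mono_interval; try lra.
    - apply ex_RInt_continuous_le; [lra | intros; apply hcxabs; lra].
    - intros x hx; apply Rmult_le_pos; [lra | apply Rabs_pos]. }
  unfold C; rewrite hb in hi1; lra. }
assert (hge : forall r, a <= r <= b -> 0 <= h r).
{ intros r hr; apply Rle_trans with (f r); auto. }
assert (hrh : forall r, a <= r <= b -> r * h r <= C).
{ intros r hr; generalize (hrC r hr).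
  enough (0 <= RInt h r b) by lra.
  apply RInt_ge_0; [lra | | intros; apply hge; lra].
  apply ex_RInt_continuous_le; [lra | intros; apply hch; lra]. }
split.
- intros r hr; apply Rle_trans with (r * h r); auto.
  apply Rmult_le_compat_l; [lra | auto].
- assert (hC : 0 <= C).
  { apply Rle_trans with (b * h b); [apply Rmult_le_pos; [lra | apply hge; lra] | apply hrh; lra]. }
  assert (hI : RInt h a b <= C).
  { generalize (hrC a ltac:(lra)) (hge a ltac:(lra)); intros.
    assert (0 <= a * h a) by (apply Rmult_le_pos; lra); lra. }
  apply Rle_trans with (RInt (fun x => scal C (h x)) a b).
  + apply RInt_le; auto.
    * apply ex_RInt_continuous_le; auto; intros x hx.
      apply (ex_derive_continuous (V := R_NormedModule)).
      auto_derive; eexists; apply hf; lra.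
    * apply (ex_RInt_scal (V := R_NormedModule)); apply ex_RInt_continuous_le; auto; intros; apply hch; lra.
    * intros x hx; change (scal ?u ?v) with (u * v).
      assert (h1 := hfh x ltac:(lra)); assert (h2 := hpos x).
      assert (h3 := hrh x ltac:(lra)).
      apply Rle_trans with (x * h x * h x); [ | apply Rmult_le_compat_r; lra].
      replace (x * f x ^ 2) with (x * (f x * f x)) by ring; rewrite Rmult_assoc.
      apply Rmult_le_compat_l; [lra | apply Rmult_le_compat; lra].
  + rewrite (RInt_scal (V := R_CompleteNormedModule)).
    2: apply ex_RInt_continuous_le; auto; intros; apply hch; lra.
    change (scal ?u ?v) with (u * v).
    replace (C ^ 2) with (C * C) by ring; now apply Rmult_le_compat_l.
Qed.

(** Cauchy-Schwarz for the weight [x dx], kept in the form given by expanding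
    x (t |A| - |B|)^2 >= 0, so that [t] may be taken to depend on the left
    integral without dividing by the integral of A^2. *)
Lemma RInt_amgm (A B : R -> R) (a b t : R) :
  0 <= a <= b ->
  (forall x, a <= x <= b -> continuous A x) ->
  (forall x, a <= x <= b -> continuous B x) ->
  t * RInt (fun x => x * Rabs (2 * A x * B x)) a b
    <= t ^ 2 * RInt (fun x => x * A x ^ 2) a b + RInt (fun x => x * B x ^ 2) a b.
Proof.
intros hab hA hB.
assert (hw : forall f, (forall x, a <= x <= b -> continuous f x) ->
  ex_RInt (fun x => x * f x) a b).
{ intros f hf; apply ex_RInt_continuous_le; [lra | ].
  intros x hx; apply (continuous_mult (K := R_AbsRing)); [apply continuous_id | auto]. }
assert (hsq : forall f, (forall x, a <= x <= b -> continuous f x) ->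
  ex_RInt (fun x => x * f x ^ 2) a b).
{ intros f hf; apply hw; intros x hx.
  apply continuous_ext with (fun y => f y * f y); [intros y; change (@eq R (f y * f y) (f y ^ 2)); ring | ].
  apply (continuous_mult (K := R_AbsRing)); auto. }
assert (hK : ex_RInt (fun x => x * Rabs (2 * A x * B x)) a b).
{ apply hw; intros x hx; apply continuous_Rabs_comp.
  apply (continuous_mult (K := R_AbsRing)); auto; apply (continuous_mult (K := R_AbsRing)); auto; apply continuous_const. }
change (t ^ 2 * ?u + ?v) with (plus (scal (t ^ 2) u) v).
change (t * ?u) with (scal t u).
assert (hA2 := hsq A hA); assert (hB2 := hsq B hB).
rewrite <- !(RInt_scal (V := R_CompleteNormedModule)) by auto.
assert (hA2' : ex_RInt (fun x => scal (t ^ 2) (x * A x ^ 2)) a b)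
  by (apply (ex_RInt_scal (V := R_NormedModule)); auto).
rewrite <- (RInt_plus (V := R_CompleteNormedModule)) by assumption.
apply RInt_le; [lra | apply (ex_RInt_scal (V := R_NormedModule)); auto | apply (ex_RInt_plus (V := R_NormedModule)); auto | ].
intros x hx.
change (t * (x * Rabs (2 * A x * B x)) <= t ^ 2 * (x * A x ^ 2) + x * B x ^ 2).
rewrite <- (pow2_abs (A x)), <- (pow2_abs (B x)), !Rabs_mult, (Rabs_pos_eq 2) by lra.
assert (0 <= x * (t * Rabs (A x) - Rabs (B x)) ^ 2)
  by (apply Rmult_le_pos; [lra | apply pow2_ge_0]).
lra.
Qed.

(** * Functions continuous relative to a closed interval *)

(** Relative continuity on [p, q] says nothing about values outside, whereas
    the mean value theorem and the integrability criteria ask for two-sided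
    continuity at the end points.  Composing with the projection onto [p, q]
    provides a function continuous everywhere that agrees with [f] there. *)
Lemma continuous_comp_clamp (f : R -> R) (p q : R) :
  p <= q -> continuous_on (fun r => p <= r <= q) f ->
  forall x, continuous (fun y => f (Rmax p (Rmin q y))) x.
Proof.
intros hpq hf x.
assert (hin : forall y, p <= Rmax p (Rmin q y) <= q).
{ intros y; split; [apply Rmax_l | apply Rmax_lub; [easy | apply Rmin_l]]. }
(* The projection onto [p, q] is 1-Lipschitz. *)
assert (hlip : forall y, Rabs (Rmax p (Rmin q y) - Rmax p (Rmin q x)) <= Rabs (y - x)).
{ intros y; unfold Rmax, Rmin.
  destruct (Rle_dec q y), (Rle_dec q x);
  repeat match goal with |- context [Rle_dec ?u ?v] => destruct (Rle_dec u v) end;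
  unfold Rabs;
  repeat match goal with |- context [Rcase_abs ?u] => destruct (Rcase_abs u) end; lra. }
unfold continuous.
eapply filterlim_comp; [ | apply (hf _ (hin x))].
intros P [e he]; exists e; intros y hy.
apply he; [ | apply hin].
apply Rle_lt_trans with (1 := hlip y), hy.
Qed.

Lemma exists_Derive_ge_0 (f : R -> R) (p q : R) :
  p < q -> continuous_on (fun r => p <= r <= q) f ->
  (forall x, p < x < q -> ex_derive f x) -> f p <= f q ->
  exists c, p < c < q /\ 0 <= Derive f c.
Proof.
intros hpq hc hd hle.
set (g := fun y => f (Rmax p (Rmin q y))).
assert (hgf : forall y, p <= y <= q -> g y = f y).
{ intros y hy; unfold g; rewrite Rmin_right, Rmax_right; lra. }
assert (hloc : forall x, p < x < q -> locally x (fun y => f y = g y)).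
{ intros x hx; apply filter_imp with (fun y => p < y < q).
  - intros y hy; symmetry; apply hgf; lra.
  - apply (open_and (fun y => p < y) (fun y => y < q)); auto using open_gt, open_lt. }
assert (hg : forall x, p < x < q -> derivable_pt g x).
{ intros x hx; apply ex_derive_Reals_0.
  apply ex_derive_ext_loc with f; auto. }
destruct (MVT g id p q hg (fun c _ => derivable_pt_id c)) as [c [hcc heq]]; auto.
- intros c _; apply continuity_pt_filterlim, continuous_comp_clamp; [lra | easy].
- intros c _; apply derivable_continuous_pt, derivable_pt_id.
- exists c; split; auto.
  rewrite derive_pt_id, (Derive_Reals g), !hgf in heq by lra.
  rewrite (Derive_ext_loc f g) by auto.
  unfold id in heq.
  apply Rmult_le_reg_l with (q - p); lra.
Qed.

Lemma ex_RInt_continuous_on (f : R -> R) (p q : R) :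
  p <= q -> continuous_on (fun r => p <= r <= q) f -> ex_RInt f p q.
Proof.
intros hpq hf.
apply ex_RInt_ext with (fun y => f (Rmax p (Rmin q y))).
- rewrite Rmin_left, Rmax_right by easy.
  intros y hy; rewrite Rmin_right, Rmax_right; lra.
- apply ex_RInt_continuous_le; auto; intros; now apply continuous_comp_clamp.
Qed.

(** * The boundary value problem *)

(** Minus the derivative of r A A' equals
    r A^4 / (1 + A^2)^2 - (m^2 + lambda r^2) A^2 / r - r A'^2 by the equation,
    and the middle term has a sign; the hypotheses at [a] and [b] make the
    increment of r A A' nonpositive. *)
Lemma energy_inequality (rad : R) (m : Z) (lambda : R) (A : R -> R) (a b : R) :
  (forall r, 0 < r < rad -> IZR m ^ 2 + r ^ 2 * lambda >= 0) ->
  twice_differentiable_on (fun r => 0 < r < rad) A ->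
  (forall r, 0 < r < rad -> ode m lambda A r) ->
  0 < a -> a <= b -> b < rad ->
  0 <= A a * Derive A a -> A b * Derive A b <= 0 ->
  RInt (fun r => r * Derive A r ^ 2) a b <= RInt (fun r => r * A r ^ 4) a b.
Proof.
intros hV hd hode h0 hab hb hAa hAb.
assert (c1 : forall x, 0 < x < rad -> continuous (fun r => r * A r ^ 4) x).
{ intros x hx; apply (ex_derive_continuous (V := R_NormedModule)).
  auto_derive; apply hd; auto. }
assert (c2 : forall x, 0 < x < rad -> continuous (fun r => r * Derive A r ^ 2) x).
{ intros x hx; apply (ex_derive_continuous (V := R_NormedModule)).
  auto_derive; apply (hd x hx). }
assert (e1 : ex_RInt (fun r => r * A r ^ 4) a b)
  by (apply ex_RInt_continuous_le; auto; intros; apply c1; lra).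
assert (e2 : ex_RInt (fun r => r * Derive A r ^ 2) a b)
  by (apply ex_RInt_continuous_le; auto; intros; apply c2; lra).
assert (hI : (- (b * (A b * Derive A b))) - (- (a * (A a * Derive A a)))
  <= RInt (fun r => minus (r * A r ^ 4) (r * Derive A r ^ 2)) a b).
{ apply (increment_le_RInt (fun r => - (r * (A r * Derive A r)))
    (fun r => - (A r * Derive A r + r * (Derive A r ^ 2 + A r * Derive (Derive A) r)))
    _ 0 rad); try lra.
  - intros x hx; auto_derive.
    + destruct (hd x hx); repeat split; auto.
    + change (fun x0 => A x0) with A. change (fun x0 => Derive A x0) with (Derive A). ring.
  - intros x hx; apply (continuous_minus (V := R_NormedModule)); auto.
  - intros x hx; change (minus ?u ?v) with (u - v).
    assert (ho := hode x hx); unfold ode in ho.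
    assert (hVx := hV x hx).
    set (D := 1 + A x ^ 2) in ho.
    assert (hD : 1 <= D) by (unfold D; generalize (pow2_ge_0 (A x)); lra).
    assert (hq : A x ^ 4 / D ^ 2 <= A x ^ 4).
    { apply Rle_div_l; [apply pow_lt; lra | ].
      rewrite <- (Rmult_1_r (A x ^ 4)) at 1.
      apply Rmult_le_compat_l; [replace (A x ^ 4) with ((A x ^ 2) ^ 2) by ring; apply pow2_ge_0 | ].
      apply pow_R1_Rle; lra. }
    assert (hA'' : A x * Derive A x + x * (A x * Derive (Derive A) x)
      = (IZR m ^ 2 + x ^ 2 * lambda) * A x ^ 2 / x - x * (A x ^ 4 / D ^ 2)).
    { replace (Derive (Derive A) x) with (- (1 / x * Derive A x) + IZR m ^ 2 / x ^ 2 * A x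
        + lambda * A x - A x ^ 3 / D ^ 2) by lra.
      field; lra. }
    assert (0 <= (IZR m ^ 2 + x ^ 2 * lambda) * A x ^ 2 / x).
    { apply Rmult_le_pos; [apply Rmult_le_pos; [lra | apply pow2_ge_0] | ].
      apply Rlt_le, Rinv_0_lt_compat; lra. }
    assert (x * (A x ^ 4 / D ^ 2) <= x * A x ^ 4) by (apply Rmult_le_compat_l; lra).
    lra. }
rewrite (RInt_minus (V := R_CompleteNormedModule)) in hI by assumption.
change (minus ?u ?v) with (u - v) in hI.
assert (0 <= a * (A a * Derive A a)) by (apply Rmult_le_pos; lra).
assert (0 <= b * (- (A b * Derive A b))) by (apply Rmult_le_pos; lra).
lra.
Qed.

Theorem theorem4p2 (rad : R) (m : Z) (lambda : R)
  (hrad : 0 < rad)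
  (hpos : forall r : R, 0 <= r <= rad -> (IZR m) ^ 2 + r ^ 2 * lambda > 0) :
  ~ exists (A : R -> R) (N0 : R),
      solution_pair rad m A lambda /\
      nontrivial rad A /\
      photon_number rad A = N0 /\
      0 < N0 <= 1 / 2.
Proof.
intros [A [N0 [[hc [hd [hode [hA0 hAR]]]] [[r0 [hr0 hne]] [hN hN0]]]]].
assert (hr : 0 < r0 < rad).
{ split; apply Rnot_le_lt; intros hle; apply hne.
  - replace r0 with 0 by lra; easy.
  - replace r0 with rad by lra; easy. }
assert (hcpow : forall x, 0 <= x <= rad ->
  filterlim (fun r => A r ^ 2) (within (fun r => 0 <= r <= rad) (locally x)) (locally (A x ^ 2))).
{ intros x hx.
  eapply filterlim_comp with (f := A) (g := fun y => y ^ 2); [apply hc, hx | ].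
  apply (ex_derive_continuous (V := R_NormedModule)); auto_derive; easy. }
(* 2 pi M = N0 <= 1/2 and pi > 2. *)
assert (hM : RInt (fun r => r * A r ^ 2) 0 rad <= 1 / 8).
{ unfold photon_number in hN.
  assert (hPI := PI2_1).
  assert (4 * RInt (fun r => r * A r ^ 2) 0 rad <= N0).
  { rewrite <- hN; apply Rmult_le_compat_r; [ | lra].
    apply Rmult_le_reg_l with (2 * PI); lra. }
  lra. }
assert (hex : ex_RInt (fun r => r * A r ^ 2) 0 rad).
{ apply ex_RInt_continuous_on; [lra | ].
  intros x hx.
  apply (filterlim_comp_2 (G := locally x) (H := locally (A x ^ 2))
    (fun r => r) (fun r => A r ^ 2) Rmult); [ | apply hcpow, hx | ].
  - intros P hP; unfold filtermap, within; revert hP; apply filter_imp; auto.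
  - apply (filterlim_mult x (A x ^ 2)). }
(* [c] is the size that b A(b)^2 has to be negligible against. *)
set (c := r0 * A r0 ^ 2).
assert (hcpos : 0 < c).
{ apply Rmult_lt_0_compat; [lra | ].
  replace (A r0 ^ 2) with (Rsqr (A r0)) by (unfold Rsqr; ring).
  now apply Rlt_0_sqr. }
assert (hdA2 : forall x, 0 < x < rad -> is_derive (fun r => A r ^ 2) x (2 * A x * Derive A x)).
{ intros x hx; destruct (hd x hx) as [h1 _].
  auto_derive; auto. change (fun x0 => A x0) with A; ring. }
assert (hdA2' : forall x, 0 < x < rad -> Derive (fun r : R => A r ^ 2) x = 2 * A x * Derive A x).
{ intros x hx; apply is_derive_unique, hdA2, hx. }
(* A^2 is nonnegative and vanishes at both ends, hence has a nonnegative
   derivative somewhere before r0 and a nonpositive one arbitrarily near [rad]. *)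
assert (ha : exists a, 0 < a < r0 /\ 0 <= A a * Derive A a).
{ destruct (exists_Derive_ge_0 (fun r => A r ^ 2) 0 r0) as [a [ha h]]; try lra.
  - apply continuous_on_subset with (fun r => 0 <= r <= rad); [intros; lra | exact hcpow].
  - intros x hx; eexists; apply hdA2; lra.
  - rewrite hA0; generalize (pow2_ge_0 (A r0)); lra.
  - exists a; split; auto.
    rewrite hdA2' in h; lra. }
assert (hb1 : exists b1, r0 < b1 < rad /\ forall x, b1 <= x <= rad -> rad * A x ^ 2 < c / 4).
{ assert (hlim := hcpow rad ltac:(lra)); rewrite hAR in hlim.
  assert (hlt : 0 < c / (4 * rad)) by (apply Rdiv_lt_0_compat; lra).
  destruct (hlim (fun y => y < c / (4 * rad))) as [e he].
  { apply open_lt; simpl; lra. }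
  set (d := Rmin (e / 2) ((rad - r0) / 2)).
  assert (hd1 : d <= e / 2) by apply Rmin_l.
  assert (hd2 : d <= (rad - r0) / 2) by apply Rmin_r.
  assert (he0 := cond_pos e).
  assert (hd0 : 0 < d) by (apply Rmin_glb_lt; lra).
  exists (rad - d); split; [lra | ]; intros x hx.
  assert (hlt' : A x ^ 2 < c / (4 * rad)).
  { apply he; [ | lra].
    change (Rabs (x - rad) < e); rewrite Rabs_left1; lra. }
  apply Rmult_lt_compat_l with (r := rad) in hlt'; [ | lra].
  replace (rad * (c / (4 * rad))) with (c / 4) in hlt' by (field; lra).
  easy. }
destruct hb1 as [b1 [hb1 hsmall]].
assert (hb : exists b, b1 < b < rad /\ A b * Derive A b <= 0).
{ destruct (exists_Derive_ge_0 (fun r => - A r ^ 2) b1 rad) as [b [hb h]]; try lra.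
  - intros x hx.
    eapply filterlim_comp with (f := fun r => A r ^ 2) (g := Ropp).
    + apply (continuous_on_subset (fun r => 0 <= r <= rad) (fun r => b1 <= r <= rad)
        (fun r => A r ^ 2)); [intros; lra | exact hcpow | exact hx].
    + apply (filterlim_opp (V := R_NormedModule)).
  - intros x hx; apply (ex_derive_opp (V := R_NormedModule)); eexists; apply hdA2; lra.
  - rewrite hAR; generalize (pow2_ge_0 (A b1)); lra.
  - exists b; split; auto.
    rewrite Derive_opp, hdA2' in h; lra. }
destruct ha as [a [ha hAa]]; destruct hb as [b [hb hAb]].
assert (hen := energy_inequality rad m lambda A a b
  ltac:(intros r hr'; apply Rgt_ge, hpos; lra) hd hode
  ltac:(lra) ltac:(lra) ltac:(lra) hAa hAb).
assert (hcA : forall x, 0 < x < rad -> continuous A x).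
{ intros x hx; apply (ex_derive_continuous (V := R_NormedModule)); apply (hd x hx). }
assert (hcA' : forall x, 0 < x < rad -> continuous (Derive A) x).
{ intros x hx; apply (ex_derive_continuous (V := R_NormedModule)); apply (hd x hx). }
destruct (radial_sobolev (fun r => A r ^ 2) (fun r => 2 * A r * Derive A r) 0 rad a b)
  as [hsup hgn]; try lra; auto.
{ intros x hx; apply (continuous_mult (K := R_AbsRing)); auto.
  apply (continuous_mult (K := R_AbsRing)); auto; apply continuous_const. }
{ intros; apply pow2_ge_0. }
set (K := RInt (fun x => x * Rabs (2 * A x * Derive A x)) a b) in *.
assert (ham := RInt_amgm A (Derive A) a b (4 * K) ltac:(lra)
  ltac:(intros; apply hcA; lra) ltac:(intros; apply hcA'; lra)).
fold K in ham.
assert (hMab : RInt (fun r => r * A r ^ 2) a b <= 1 / 8).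
{ apply Rle_trans with (2 := hM).
  apply RInt_mono_interval; try lra; auto.
  intros; apply Rmult_le_pos; [lra | apply pow2_ge_0]. }
assert (heq : RInt (fun x => x * (A x ^ 2) ^ 2) a b = RInt (fun r => r * A r ^ 4) a b).
{ apply RInt_ext; intros x _; change (@eq R (x * (A x ^ 2) ^ 2) (x * A x ^ 4)); ring. }
rewrite heq in hgn.
specialize (hsup r0 ltac:(lra)); fold c in hsup.
set (eps := b * A b ^ 2) in *.
assert (heps : 0 <= eps < c / 4).
{ split; [apply Rmult_le_pos; [lra | apply pow2_ge_0] | ].
  apply Rle_lt_trans with (2 := hsmall b ltac:(lra)).
  apply Rmult_le_compat_r; [apply pow2_ge_0 | lra]. }
assert (hK2 : (4 * K) ^ 2 * RInt (fun r => r * A r ^ 2) a b <= (4 * K) ^ 2 * (1 / 8)).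
{ apply Rmult_le_compat_l; [apply pow2_ge_0 | easy]. }
(* With t = 4 K: 4 K^2 <= 16 K^2 / 8 + G. *)
assert (hfin : 2 * K ^ 2 <= (eps + K) ^ 2) by lra.
(* [c <= eps + K] and [eps < c / 4]. *)
assert (hKe : 3 * eps <= K) by lra.
assert (0 < K) by lra.
assert ((eps + K) ^ 2 <= (4 / 3 * K) ^ 2) by (apply pow_incr; lra).
assert (0 < K ^ 2) by (apply pow_lt; lra).
lra.
Qed.
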